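(* Let $(f_n:U\to\mathbb{R})_{n\in\mathbb{N}}$ be a sequence of (ordinary) smooth functions defined on an open subset $U$ of $\mathbb{R}^m$. Then $(f_n)_{n\in\mathbb{N}}$ is pointwise Taylor convergent if and only if the sequence of Fermat extensions $({}^{\bullet}f_n:{}^{\bullet}U\to{}^{\bullet}\mathbb{R})_{n\in\mathbb{N}}$ is pointwise convergent in the Euclidean topology.
   Context: Fermat reals: for $U\subseteq\mathbb{R}^n$ open, a little-oh polynomial on $U$ is a function $x:[0,\epsilon)\to U$ ($\epsilon>0$ depending on $x$) such that $x(t)=r+\sum_{i=1}^k\alpha_i t^{a_i}+o(t)$ as $t\to0^+$ for some $k\in\mathbb{N}$, $\alpha_i\in\mathbb{R}^n$, $a_i>0$, with $r=x(0)\in U$. Two such $x,y$ are equivalent if $x(0)=y(0)$ and $x(t)-y(t)=o(t)$; the quotient set is ${}^{\bullet}U$. Every $x\in{}^{\bullet}U$ is uniquely of the form $x={}^{\circ}x+\sum_{i\in(0,1]_{\mathbb{R}}}\alpha_i t^{i}$ with ${}^{\circ}x\in U$ (standard part), $\alpha_i\in\mathbb{R}^n$, all but finitely many $\alpha_i$ equal to $0$ (the quasi-decomposition of $x$); $(0,1]_{\mathbb{R}}$ is the usual real interval. For smooth $f:U\to\mathbb{R}$ the Fermat extension is ${}^{\bullet}f:{}^{\bullet}U\to{}^{\bullet}\mathbb{R}$, ${}^{\bullet}f([x])=[f\circ x]$. The Euclidean topology on ${}^{\bullet}\mathbb{R}$ is the one induced by the inner product $\langle x,y\rangle={}^{\circ}x\,{}^{\circ}y+\sum_{i\in(0,1]_{\mathbb{R}}}\alpha_i\beta_i$,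 where $x={}^{\circ}x+\sum\alpha_i t^i$, $y={}^{\circ}y+\sum\beta_i t^i$ are quasi-decompositions. A sequence of functions $g_n:A\to{}^{\bullet}\mathbb{R}$ is pointwise convergent in a topology if for each $x\in A$ the sequence $(g_n(x))_n$ has a limit in ${}^{\bullet}\mathbb{R}$. $(f_n:U\to\mathbb{R})_n$ is pointwise Taylor convergent if for every multi-index $k\in\mathbb{N}^m$ (with $0\in\mathbb{N}$) the sequence $(\partial^{|k|}f_n/\partial x^k)_n$ converges pointwise on $U$. *)

(* Defs.v *)
From HB Require Import structures.
From mathcomp Require Import all_boot all_order all_algebra.
From mathcomp Require Import generic_quotient.
From mathcomp Require Import all_classical all_reals all_analysis.

Set Implicit Arguments.
Unset Strict Implicit.
Unset Printing Implicit Defensive.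

Import Order.TTheory GRing.Theory Num.Theory.
Import numFieldNormedType.Exports.

Local Open Scope classical_set_scope.
Local Open Scope ring_scope.
Local Open Scope quotient_scope.

Section LittleOhPolynomials.
Context {R : realType} {V : normedModType R}.

Lemma little0 : (fun=> 0 : V) =o_ (0^'+) (id : R -> R^o).
Proof. by apply/eqoP; exact: littleo0_subproof. Qed.

Lemma littleD (f g : R -> V) : f =o_ (0^'+) (id : R -> R^o) ->
  g =o_ (0^'+) (id : R -> R^o) -> (fun t => f t + g t) =o_ (0^'+) (id : R -> R^o).
Proof. by move=> fo go; rewrite -[LHS]/(f + g) fo go addo. Qed.

Lemma littleN (f : R -> V) : f =o_ (0^'+) (id : R -> R^o) ->
  (fun t => - f t) =o_ (0^'+) (id : R -> R^o).
Proof. by move=> fo; rewrite -[LHS]/(- f) fo oppo. Qed.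

Lemma eq_little (f g : R -> V) :
  f =1 g -> f =o_ (0^'+) (id : R -> R^o) -> g =o_ (0^'+) (id : R -> R^o).
Proof. by move=> /funext ->. Qed.

(* A finite family of coefficients and positive exponents is coded as a list
   of pairs (coefficient, exponent). *)
Definition has_expansion (x : R -> V) : Prop :=
  exists2 s : seq (V * R), (forall p, p \in s -> 0 < p.2) &
    (fun t : R => x t - (x 0 + \sum_(p <- s) t `^ p.2 *: p.1))
      =o_ (0^'+) (id : R -> R^o).

(* Only the values of [lop_fun] on [0, lop_eps) are meaningful. *)
Record lop (U : set V) := Lop {
  lop_fun :> R -> V;
  lop_eps : R;
  lop_eps_gt0 : 0 < lop_eps;
  lop_mem : forall t, 0 <= t < lop_eps -> U (lop_fun t);
  lop_expansion : has_expansion lop_fun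
}.

HB.instance Definition _ U := gen_eqMixin (lop U).
HB.instance Definition _ U := gen_choiceMixin (lop U).

Definition lop_equiv_prop (U : set V) (x y : lop U) : Prop :=
  x 0 = y 0 /\ (fun t : R => x t - y t) =o_ (0^'+) (id : R -> R^o).

Definition lop_equiv (U : set V) : rel (lop U) :=
  fun x y => `[< lop_equiv_prop x y >].

Lemma lop_equiv_refl U : reflexive (@lop_equiv U).
Proof.
move=> x; apply/asboolP; split=> //.
by under eq_fun do rewrite subrr; exact: little0.
Qed.

Lemma lop_equiv_sym U : symmetric (@lop_equiv U).
Proof.
suff H x y : lop_equiv_prop x y -> lop_equiv_prop (U := U) y x.
  by move=> x y; apply/asboolP/asboolP; exact: H.
move=> [xy0 /littleN xy]; split=> //.
by apply: eq_little xy => t; rewrite opprB.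
Qed.

Lemma lop_equiv_trans U : transitive (@lop_equiv U).
Proof.
move=> y x z /asboolP [xy0 xy] /asboolP [yz0 yz]; apply/asboolP.
split; first by rewrite xy0.
apply: eq_little (littleD xy yz) => t.
by rewrite subrKA.
Qed.

Canonical lop_equiv_rel U :=
  EquivRel (@lop_equiv U) (@lop_equiv_refl U) (@lop_equiv_sym U)
    (@lop_equiv_trans U).

Definition fermat (U : set V) : Type := {eq_quot (@lop_equiv_rel U)}.
HB.instance Definition _ U := Choice.on (fermat U).
HB.instance Definition _ U := EqQuotient.on (fermat U).

Lemma fermatP U (x y : lop U) :
  reflect (lop_equiv_prop x y) (\pi_(fermat U) x == \pi_(fermat U) y).
Proof. by rewrite eqmodE; apply/asboolP. Qed.

Definition standard_part U (X : fermat U) : V := repr X 0.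

(* [alpha] is indexed by all reals, vanishing outside (0, 1]; [X] is the class of
   [t |-> standard_part X + \sum_i t ^ i alpha_i], restricted to a small [0, eps)
   on which it takes its values in [U]. *)
Definition quasi_decomposition U (X : fermat U) (alpha : R -> V) : Prop :=
  [/\ finite_set [set i | alpha i != 0],
      (forall i, ~ `]0, 1]%classic i -> alpha i = 0) &
      exists2 x : lop U, X = \pi_(fermat U) x & forall t, 0 <= t < lop_eps x ->
        x t = standard_part X + \sum_(i \in `]0, 1]%classic) t `^ i *: alpha i].

(* The quasi-decomposition exists and is unique when [U] is open. *)
Definition quasi_coef U (X : fermat U) : R -> V :=
  get [set alpha | quasi_decomposition X alpha].

Lemma expansionD x y :
  has_expansion x -> has_expansion y -> has_expansion (fun t => x t + y t).
Proof.
move=> [s sp sx] [u up uy]; exists (s ++ u).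
  by move=> p; rewrite mem_cat => /orP[/sp|/up].
apply: eq_little (littleD sx uy) => t.
by rewrite big_cat/= addrACA -opprD; congr (_ - _); rewrite addrACA.
Qed.

Lemma expansionN x : has_expansion x -> has_expansion (fun t => - x t).
Proof.
move=> [s sp /littleN sx]; exists [seq (- p.1, p.2) | p <- s].
  by move=> _ /mapP[p /sp p0 ->].
apply: eq_little sx => t.
rewrite big_map/= opprD; congr (_ - _).
by rewrite opprD -sumrN; under [in RHS]eq_bigr do rewrite scalerN.
Qed.

Lemma expansion0 : has_expansion (fun=> 0).
Proof.
exists [::] => //; under eq_fun do rewrite big_nil addr0 subrr.
exact: little0.
Qed.

Definition lop0 : lop [set: V] :=
  @Lop [set: V] (fun=> 0) 1 ltr01 (fun _ _ => I) expansion0.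

Definition lopN (x : lop [set: V]) : lop [set: V] :=
  @Lop [set: V] (fun t => - x t) (lop_eps x) (lop_eps_gt0 x) (fun _ _ => I)
    (expansionN (lop_expansion x)).

Lemma lopD_eps_gt0 (x y : lop [set: V]) : 0 < Num.min (lop_eps x) (lop_eps y).
Proof. by rewrite lt_min !lop_eps_gt0. Qed.

Definition lopD (x y : lop [set: V]) : lop [set: V] :=
  @Lop [set: V] (fun t => x t + y t) (Num.min (lop_eps x) (lop_eps y))
    (lopD_eps_gt0 x y) (fun _ _ => I)
    (expansionD (lop_expansion x) (lop_expansion y)).

End LittleOhPolynomials.

Section FermatReals.
Variable R : realType.

Definition fermat_real : Type := fermat [set: R^o].
HB.instance Definition _ := Choice.on fermat_real.
HB.instance Definition _ := EqQuotient.on fermat_real.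

Definition fermat_real0 : fermat_real := \pi lop0.
Definition fermat_realN : fermat_real -> fermat_real :=
  lift_op1 fermat_real (@lopN R R^o).
Definition fermat_realD : fermat_real -> fermat_real -> fermat_real :=
  lift_op2 fermat_real (@lopD R R^o).

Lemma pi_fermat_realN : {morph \pi_fermat_real : x / lopN x >-> fermat_realN x}.
Proof.
move=> x; unlock fermat_realN; apply/eqP/fermatP.
have /eqP/fermatP[xr0 /littleN xr] := esym (reprK (\pi_fermat_real x)).
split=> /=; first by rewrite xr0.
by apply: eq_little xr => t; rewrite opprD.
Qed.

Lemma pi_fermat_realD :
  {morph \pi_fermat_real : x y / lopD x y >-> fermat_realD x y}.
Proof.
move=> x y; unlock fermat_realD; apply/eqP/fermatP.
have /eqP/fermatP[xr0 xr] := esym (reprK (\pi_fermat_real x)).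
have /eqP/fermatP[yr0 yr] := esym (reprK (\pi_fermat_real y)).
split=> /=; first by rewrite xr0 yr0.
apply: eq_little (littleD xr yr) => t.
by rewrite opprD addrACA.
Qed.

Lemma lop_eq_pi (x y : lop [set: R^o]) :
  lop_fun x =1 y -> \pi_fermat_real x = \pi_fermat_real y.
Proof.
move=> xy; apply/eqP/fermatP; split; first exact: xy.
by under eq_fun do rewrite xy subrr; exact: little0.
Qed.

Lemma fermat_realDA : associative fermat_realD.
Proof.
move=> x y z; rewrite -(reprK x) -(reprK y) -(reprK z) -!pi_fermat_realD.
by apply: lop_eq_pi => t /=; rewrite addrA.
Qed.

Lemma fermat_realDC : commutative fermat_realD.
Proof.
move=> x y; rewrite -(reprK x) -(reprK y) -!pi_fermat_realD.
by apply: lop_eq_pi => t /=; rewrite addrC.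
Qed.

Lemma fermat_real0D : left_id fermat_real0 fermat_realD.
Proof.
move=> x; rewrite -(reprK x) -pi_fermat_realD.
by apply: lop_eq_pi => t /=; rewrite add0r.
Qed.

Lemma fermat_realND : left_inverse fermat_real0 fermat_realN fermat_realD.
Proof.
move=> x; rewrite -(reprK x) -pi_fermat_realN -pi_fermat_realD.
by apply: lop_eq_pi => t /=; rewrite addNr.
Qed.

HB.instance Definition _ := GRing.isZmodule.Build fermat_real
  fermat_realDA fermat_realDC fermat_real0D fermat_realND.

Definition fermat_inner (x y : fermat_real) : R :=
  standard_part x * standard_part y +
  \sum_(i \in `]0, 1]%classic) (quasi_coef x i * quasi_coef y i : R).

Definition fermat_norm (x : fermat_real) : R := Num.sqrt (fermat_inner x x).

Definition euclidean_open (O : set fermat_real) : Prop :=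
  forall x, O x ->
    exists2 e : R, 0 < e & forall y, fermat_norm (y - x) < e -> O y.

Lemma euclidean_openT : euclidean_open setT.
Proof. by move=> x _; exists 1. Qed.

Lemma euclidean_openI (A B : set fermat_real) :
  euclidean_open A -> euclidean_open B -> euclidean_open (A `&` B).
Proof.
move=> oA oB x [/oA[a a0 Aa] /oB[b b0 Bb]].
exists (Num.min a b); first by rewrite lt_min a0.
by move=> y; rewrite lt_min => /andP[/Aa ? /Bb].
Qed.

Lemma euclidean_open_bigcup (I : Type) (f : I -> set fermat_real) :
  (forall i, euclidean_open (f i)) -> euclidean_open (\bigcup_i f i).
Proof.
move=> of_ x [i _ /of_[e e0 fe]]; exists e => // y /fe fy.
by exists i.
Qed.

(* The canonical topology of [fermat_real] is the Euclidean one (and not, say,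
   a quotient topology). *)
HB.instance Definition _ := @isOpenTopological.Build fermat_real
  euclidean_open euclidean_openT euclidean_openI euclidean_open_bigcup.

Lemma fermat_real_openE : (@open fermat_real) = euclidean_open.
Proof. by []. Qed.

End FermatReals.

(* A function on an open set [U] is represented by a total function; as [U] is
   open, its iterated partial derivatives at points of [U] and its Fermat
   extension to [fermat U] only depend on its restriction to [U]. *)
Section Smooth.
Variables (R : realType) (m : nat).
Implicit Types (f : 'rV[R]_m -> R) (U : set 'rV[R]_m).

Definition partial (i : 'I_m) f : 'rV[R]_m -> R :=
  fun x => 'D_(delta_mx ord0 i) (f : 'rV[R]_m -> R^o) x.

(* [iter_partial [:: i1; ..; ip] f] is the derivative of [f] with respect to
   [ip] first and [i1] last. *)
Definition iter_partial (s : seq 'I_m) f : 'rV[R]_m -> R := foldr partial f s.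

Definition smooth_on U f : Prop :=
  forall (s : seq 'I_m) x, U x ->
    {for x, continuous (iter_partial s f)} /\
    forall i : 'I_m,
      derivable (iter_partial s f : 'rV[R]_m -> R^o) x (delta_mx ord0 i).

Definition multi_partial (k : 'I_m -> nat) f : 'rV[R]_m -> R :=
  iter_partial (flatten [seq nseq (k i) i | i <- enum 'I_m]) f.

Definition pointwise_Taylor_convergent U (f : nat -> 'rV[R]_m -> R) : Prop :=
  forall k : 'I_m -> nat, forall x, U x ->
    exists l : R, multi_partial k (f n) x @[n --> \oo] --> l.

(* The function whose graph is the set of pairs ([x], [f o x]). For [f] smooth
   on the open set [U] this graph is total and single-valued, so the default
   value 0 is not used. *)
Definition fermat_ext U f (X : fermat U) : fermat_real R :=
  xget 0 [set Y : fermat_real R | exists (x : lop U) (y : lop [set: R^o]),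
    [/\ X = \pi_(fermat U) x, Y = \pi_(fermat_real R) y, lop_eps y = lop_eps x
      & forall t, 0 <= t < lop_eps x -> y t = f (x t)]].

End Smooth.

Definition pointwise_convergent (A : Type) (T : topologicalType)
    (g : nat -> A -> T) : Prop :=
  forall x : A, exists l : T, g n x @[n --> \oo] --> l.

(* Main.v *)
(* Proof idea. If x(t) = r + sum_p alpha_p t^p + o(t), then Taylor's formula at r
   gives f(x(t)) as a finite linear combination, modulo o(t), of generalized
   monomials in t depending on x only, with the partial derivatives of f at r as
   coefficients; so convergence of all derivatives at r gives convergence of the
   finitely many coefficients of the Fermat extensions at [x]. Conversely, for the
   curve r + (t^(a_1), ..., t^(a_m)) the derivative of multi-index k contributes to
   the exponent sum_i k_i a_i, and the a_i can be chosen so that a given k is the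
   only one contributing to its exponent. *)
Require Import Defs.
From mathcomp Require Import all_boot all_order all_algebra generic_quotient.
From mathcomp Require Import all_classical all_reals all_analysis.
From mathcomp Require Import ring.

Set Implicit Arguments.
Unset Strict Implicit.
Unset Printing Implicit Defensive.

Import Order.TTheory GRing.Theory Num.Theory.
Import numFieldNormedType.Exports.
Local Open Scope classical_set_scope.
Local Open Scope ring_scope.
Local Open Scope quotient_scope.

(** * Little-oh functions at 0+ *)

(** Everything passes through coefficients. [quasi_coef] and [fermat_ext] are defined by choice, so
    nothing can be computed from them directly; but a function near 0+ determines, modulo o(t), its
    coefficients at exponents at most 1 ([psum_littleo_coef0]), so any expansion of any
    representative yields them. The Euclidean topology then enters through two facts: each
    coefficient is 1-Lipschitz for [fermat_norm], and the squared norm of a difference is a sum of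
    squares over finitely many exponents that can be fixed independently of n. The latter holds
    because the Taylor order is dictated by the smallest exponent of the curve, not by [f n]. In the
    converse the exponents a_i meet two opposing demands: the exponent of k must be at most 1, since
    larger ones are invisible modulo o(t), while each a_i must exceed 1/(|k|+1), so that Taylor's
    formula with all partial orders at most |k| already has error o(t) and finitely many
    multi-indices compete. *)

Section LittleOh.
Context {R : realType}.
Implicit Types g h : R -> R^o.

Lemma cvg_sumr (T I : Type) (F : set_system T) (FF : Filter F) (s : seq I) (P : pred I)
    (G : I -> T -> R) (l : I -> R) :
  (forall i, P i -> G i t @[t --> F] --> l i) ->
  (\sum_(i <- s | P i) G i t) @[t --> F] --> \sum_(i <- s | P i) l i.
Proof. by apply: cvg_big => z; apply: cvgD; [exact: cvg_fst | exact: cvg_snd]. Qed.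

Lemma littleo_idP g :
  g =o_ (0^'+) (id : R -> R^o) <-> (g t / t : R) @[t --> 0^'+] --> (0 : R).
Proof.
split=> [/eqoP go | go].
  apply/cvgr0Pnorm_le => e e0; near=> t.
  have t0 : 0 < t by near: t; exact: nbhs_right_gt.
  rewrite normrM normfV (gtr0_norm t0) ler_pdivrMr// -{2}(gtr0_norm t0).
  by near: t; exact: go.
apply/eqoP => e e0; near=> t.
have t0 : 0 < t by near: t; exact: nbhs_right_gt.
rewrite /= [X in _ <= _ * X](gtr0_norm t0) -ler_pdivrMr//.
have -> : `|g t| / t = `|(g t : R) / t| by rewrite normrM normfV (gtr0_norm t0).
by near: t; move/cvgr0Pnorm_le : go => /(_ _ e0).
Unshelve. all: by end_near. Qed.

Lemma littleoMr g h (l : R) :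
  g =o_ (0^'+) (id : R -> R^o) -> (h t : R) @[t --> 0^'+] --> l ->
  (fun t => g t * h t : R^o) =o_ (0^'+) (id : R -> R^o).
Proof.
move=> /littleo_idP go hl; apply/littleo_idP.
have H : (g t / t * h t : R) @[t --> 0^'+] --> (0 * l : R) by exact: cvgM.
by move: H; rewrite mul0r; under eq_fun do rewrite mulrAC.
Qed.

Lemma littleoMl g h (l : R) :
  (h t : R) @[t --> 0^'+] --> l -> g =o_ (0^'+) (id : R -> R^o) ->
  (fun t => h t * g t : R^o) =o_ (0^'+) (id : R -> R^o).
Proof. by move=> hl go; apply: eq_little (littleoMr go hl) => t; rewrite mulrC. Qed.

Lemma littleo_sum (I : Type) (s : seq I) (P : pred I) (G : I -> R -> R^o) :
  (forall i, P i -> G i =o_ (0^'+) (id : R -> R^o)) ->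
  (fun t => \sum_(i <- s | P i) G i t) =o_ (0^'+) (id : R -> R^o).
Proof.
move=> Go; elim: s => [|i s IH].
  by apply: eq_little little0 => t; rewrite big_nil.
have [Pi|Pi] := boolP (P i).
  by apply: eq_little (littleD (Go _ Pi) IH) => t; rewrite big_cons Pi.
by apply: eq_little IH => t; rewrite big_cons (negbTE Pi).
Qed.

Lemma littleo_cvg0 g :
  g =o_ (0^'+) (id : R -> R^o) -> (g t : R) @[t --> 0^'+] --> (0 : R).
Proof.
move=> /littleo_idP go.
have H : (g t / t * t : R) @[t --> 0^'+] --> (0 * 0 : R).
  by apply: cvgM => //; apply: cvg_at_right_filter; exact: cvg_id.
rewrite mulr0 in H; apply: cvg_trans H; apply: near_eq_cvg.
near=> t; rewrite divfK// gt_eqF//; near: t; exact: nbhs_right_gt.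
Unshelve. all: by end_near. Qed.

Lemma littleo_le g h :
  (\forall t \near 0^'+, `|g t| <= `|h t|) ->
  h =o_ (0^'+) (id : R -> R^o) -> g =o_ (0^'+) (id : R -> R^o).
Proof.
move=> gh /eqoP ho; apply/eqoP => e e0.
by apply: filterS2 gh (ho e e0) => t; exact: le_trans.
Qed.

Lemma littleo_powR (a : R) : 1 < a ->
  (fun t : R => t `^ a : R^o) =o_ (0^'+) (id : R -> R^o).
Proof.
move=> a1; apply/littleo_idP.
have := @powR_cvg0 R (a - 1); rewrite subr_gt0 => /(_ a1).
apply: cvg_trans; apply: near_eq_cvg; near=> t.
have t0 : t != 0 by rewrite gt_eqF//; near: t; exact: nbhs_right_gt.
rewrite powRD; last by rewrite t0 implybT.
by rewrite powR_inv1//; apply: ltW; near: t; exact: nbhs_right_gt.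
Unshelve. all: by end_near. Qed.

End LittleOh.

(** * Finite sums of real powers *)

Section GeneralizedPolynomials.
Context {R : realType}.
Implicit Types (s u : seq (R * R)) (i t : R).

(** Lists of (coefficient, exponent) are never normalised: exponents may repeat, vanish or exceed 1.
    Linear combinations and products then stay plain list operations, and [psum_coef] adds up the
    entries sharing an exponent. *)
Definition psum s t : R := \sum_(p <- s) t `^ p.2 * p.1.

Definition psum_coef s i : R := \sum_(p <- s | p.2 == i) p.1.

Lemma psumE s t :
  psum s t =
  \sum_(i <- [seq i <- undup (map snd s) | psum_coef s i != 0]) t `^ i * psum_coef s i.
Proof.
rewrite big_filter big_mkcond/=.
transitivity (\sum_(i <- undup (map snd s)) t `^ i * psum_coef s i); last first.
  by apply: eq_bigr => i _; case: eqVneq => // ->; rewrite mulr0.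
under eq_bigr do rewrite /psum_coef big_distrr/= big_mkcond/=.
rewrite exchange_big/= /psum !big_seq; apply: eq_bigr => p ps.
rewrite (bigD1_seq p.2) ?undup_uniq ?mem_undup ?map_f//= eqxx big1 ?addr0//.
by move=> i; rewrite eq_sym => /negbTE ->.
Qed.

(** Leading-term argument: if some coefficient at an exponent at most 1 were nonzero, the least
    exponent [i0] with nonzero coefficient would be at most 1, and dividing by t^i0 would isolate
    that coefficient in the limit; yet the quotient equals (psum / t) t^(1 - i0), which tends to
    0. *)
Lemma psum_littleo_coef0 s i :
  (psum s : R -> R^o) =o_ (0^'+) (id : R -> R^o) -> i <= 1 -> psum_coef s i = 0.
Proof.
have min_seq (D : seq R) j : j \in D ->
    exists i0, [/\ i0 \in D, i0 <= j & forall l, l \in D -> i0 <= l].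
  elim: D j => // a D IH j; case: D IH => [_|b D /(_ b)].
    by rewrite inE => /eqP ->; exists a; split; rewrite ?inE//= => l; rewrite inE => /eqP ->.
  rewrite inE eqxx => /(_ isT)[c [cD _ cmin]] jD.
  suff [d dD dmin] : exists2 d, d \in [:: a, b & D] & forall l, l \in [:: a, b & D] -> d <= l.
    by exists d; split => //; exact: dmin.
  have [ac|ca] := leP a c.
    exists a; first by rewrite inE eqxx.
    by move=> l; rewrite inE => /predU1P[->//|/cmin]; exact: le_trans.
  exists c; first by rewrite inE cD orbT.
  by move=> l; rewrite inE => /predU1P[->|/cmin//]; exact: ltW.
move=> /littleo_idP so i1; apply/eqP/contraT => ci0.
set D := [seq i <- undup (map snd s) | psum_coef s i != 0].
have [|i0 [i0D i0i i0min]] := min_seq D i.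
  rewrite mem_filter ci0 mem_undup/=; apply: contraNT ci0 => iD.
  rewrite /psum_coef big_seq_cond big_pred0// => p; apply/andP => -[ps /eqP pi].
  by rewrite -pi map_f in iD.
have {i1 i0i}i01 := le_trans i0i i1.
have [l tl] : exists l, (t `^ (1 - i0) : R) @[t --> 0^'+] --> (l : R).
  move: i01; rewrite le_eqVlt => /predU1P[->|i01].
    by exists 1; rewrite subrr; under eq_fun do rewrite powRr0; exact: cvg_cst.
  by exists 0; apply: powR_cvg0; rewrite subr_gt0.
have lim0 : (psum s t / t * t `^ (1 - i0) : R) @[t --> 0^'+] --> (0 * l : R).
  exact: cvgM.
have lim1 : (\sum_(i <- D) t `^ (i - i0) * psum_coef s i : R) @[t --> 0^'+] -->
    (\sum_(i <- D) (i == i0)%:R * psum_coef s i : R).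
  rewrite big_seq; under eq_fun do rewrite big_seq.
  apply: cvg_big => [|j jD]; first exact: add_continuous; apply: cvgM; last exact: cvg_cst.
  have := i0min _ jD; rewrite le_eqVlt => /predU1P[<-|i0j].
    by rewrite eqxx subrr; under eq_fun do rewrite powRr0; exact: cvg_cst.
  by rewrite (gt_eqF i0j); apply: powR_cvg0; rewrite subr_gt0.
have : \sum_(i <- D) (i == i0)%:R * psum_coef s i = 0 * l.
  rewrite -(cvg_lim _ lim0)//; apply/esym/cvg_lim => //; apply: cvg_trans lim1; apply: near_eq_cvg; near=> t.
  have t0 : 0 < t by near: t; exact: nbhs_right_gt.
  rewrite psumE -/D !mulr_suml; apply: eq_bigr => j _.
  have -> : t `^ (j - i0) = t `^ j / t * t `^ (1 - i0).
    rewrite -[t^-1]powR_inv1 ?ltW// -!powRD ?(gt_eqF t0) ?implybT//.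
    by congr (_ `^ _); ring.
  by ring.
rewrite mul0r (bigD1_seq i0) ?filter_uniq ?undup_uniq//= eqxx mul1r big1 ?addr0.
  by move=> c0; move: i0D; rewrite mem_filter c0 eqxx.
by move=> j /negbTE ->; rewrite mul0r.
Unshelve. all: by end_near. Qed.

Definition pscale (c : R) s : seq (R * R) := [seq (c * p.1, p.2) | p <- s].

Definition pmul s u : seq (R * R) := [seq (p.1 * q.1, p.2 + q.2) | p <- s, q <- u].

(** The scalars [c] are kept apart from the lists [e] because, in the application, [c] collects the
    derivatives of [f n] and varies with n, whereas [e] depends on the curve alone. *)
Definition plin (I : Type) (K : seq I) (c : I -> R) (e : I -> seq (R * R)) :
  seq (R * R) := flatten [seq pscale (c k) (e k) | k <- K].

Lemma psum_plin I K c e t : psum (@plin I K c e) t = \sum_(k <- K) c k * psum (e k) t.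
Proof.
rewrite /psum big_flatten big_map; apply: eq_bigr => k _.
by rewrite big_map/= mulr_sumr; apply: eq_bigr => p _; rewrite mulrCA.
Qed.

Lemma psum_coef_plin I K c e i :
  psum_coef (@plin I K c e) i = \sum_(k <- K) c k * psum_coef (e k) i.
Proof.
rewrite /psum_coef big_flatten big_map; apply: eq_bigr => k _.
by rewrite big_map/= mulr_sumr.
Qed.

Lemma psum_coef_cons p s i :
  psum_coef (p :: s) i = (if p.2 == i then p.1 else 0) + psum_coef s i.
Proof. by rewrite /psum_coef big_cons; case: ifP; rewrite ?add0r. Qed.

Lemma psum_coef1 p i : psum_coef [:: p] i = if p.2 == i then p.1 else 0.
Proof. by rewrite psum_coef_cons /psum_coef big_nil addr0. Qed.

Lemma psum_pmul s u t : 0 < t -> psum (pmul s u) t = psum s t * psum u t.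
Proof.
move=> t0; rewrite /psum big_allpairs_dep/= mulr_suml; apply: eq_bigr => p _.
rewrite mulr_sumr; apply: eq_bigr => q _.
by rewrite powRD ?(gt_eqF t0) ?implybT//; ring.
Qed.

(** Unlike in [has_expansion], the constant term is an ordinary entry of exponent 0 and the value of
    [g] at 0 does not occur: only the germ of [g] at 0+ matters. *)
Definition expands (g : R -> R) s :=
  (forall p, p \in s -> 0 <= p.2) /\
  (fun t => g t - psum s t : R^o) =o_ (0^'+) (id : R -> R^o).

Lemma expands_psum s : (forall p, p \in s -> 0 <= p.2) -> expands (psum s) s.
Proof. by split=> //; apply: eq_little little0 => t; rewrite subrr. Qed.

Lemma expands_near g h s :
  (\forall t \near 0^'+, g t = h t) -> expands g s -> expands h s.
Proof.
move=> gh [s0 gs]; split => //; apply: littleo_le gs.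
by apply: filterS gh => t ->.
Qed.

Lemma expandsD_little g h s :
  (fun t => h t - g t : R^o) =o_ (0^'+) (id : R -> R^o) ->
  expands g s -> expands h s.
Proof.
move=> hg [s0 gs]; split => //; apply: eq_little (littleD hg gs) => t.
by rewrite /= addrA subrK.
Qed.

Lemma expands_coef_eq g s u i :
  expands g s -> expands g u -> i <= 1 -> psum_coef s i = psum_coef u i.
Proof.
move=> [_ gs] [_ gu] i1; apply/eqP; rewrite -subr_eq0; apply/eqP.
(* Booleans index the two lists, so that the difference is a [plin] and its coefficients come from
   linearity. *)
pose K := [:: true; false]; pose c b : R := if b then 1 else -1.
pose e b := if b then s else u.
have := @psum_littleo_coef0 (plin K c e) i; rewrite psum_coef_plin !big_cons big_nil/=.
rewrite mul1r mulN1r addr0; apply => //.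
apply: eq_little (littleD gu (littleN gs)) => t.
rewrite psum_plin !big_cons big_nil/=; ring.
Qed.

Lemma psum_coef_map (r : seq R) (alpha : R -> R) i : uniq r ->
  psum_coef [seq (alpha j, j) | j <- r] i = if i \in r then alpha i else 0.
Proof.
move=> ur; rewrite /psum_coef big_map/=; case: ifPn => ir.
  rewrite -big_filter (eq_in_filter (a2 := pred1 i))//.
  by rewrite filter_pred1_uniq// big_seq1.
rewrite big_seq_cond big_pred0// => j.
by apply/negbTE; apply: contra ir => /andP[jr /eqP <-].
Qed.

Lemma psum_coef_notin s i : i \notin map snd s -> psum_coef s i = 0.
Proof.
move=> iD; rewrite /psum_coef big_seq_cond big_pred0// => p.
by apply/negbTE; apply: contra iD => /andP[ps /eqP <-]; exact: map_f.
Qed.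

(** Converse of [psum_littleo_coef0]: once equal exponents are collected by [psumE], only powers
    above 1 survive. *)
Lemma psum_littleo s : (forall i, i <= 1 -> psum_coef s i = 0) ->
  (psum s : R -> R^o) =o_ (0^'+) (id : R -> R^o).
Proof.
move=> s0; set D := [seq i <- undup (map snd s) | psum_coef s i != 0].
have o i : i \in D -> (fun t => t `^ i * psum_coef s i : R^o) =o_ (0^'+) (id : R -> R^o).
  rewrite mem_filter => /andP[ci _].
  apply: littleoMr (cvg_cst _); apply: littleo_powR.
  by rewrite ltNge; apply: contra ci => /s0 ->.
by apply: eq_little (littleo_sum D o) => t; rewrite -big_seq psumE.
Qed.

Lemma expands_littleo g h s u : expands g s -> expands h u ->
  (forall i, 0 <= i <= 1 -> psum_coef s i = psum_coef u i) ->
  (fun t => g t - h t : R^o) =o_ (0^'+) (id : R -> R^o).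
Proof.
move=> [s0 gs] [u0 hu] su.
pose c b : R := if b then 1 else -1.
pose e b := if b then s else u.
have o : (psum (plin [:: true; false] c e) : R -> R^o) =o_ (0^'+) (id : R -> R^o).
  apply: psum_littleo => i i1.
  rewrite psum_coef_plin !big_cons big_nil/= mul1r mulN1r addr0.
  have [i0|i0] := leP 0 i; first by rewrite su ?i0// subrr.
  rewrite !psum_coef_notin ?subrr//; apply/negP => /mapP[p].
    by move=> /u0 + pi; rewrite -pi leNgt i0.
  by move=> /s0 + pi; rewrite -pi leNgt i0.
apply: eq_little (littleD (littleD gs o) (littleN hu)) => t.
by rewrite /= psum_plin !big_cons big_nil/=; ring.
Qed.

Lemma psum_cvg0 s : (forall p, p \in s -> 0 <= p.2) ->
  psum s t @[t --> 0^'+] --> psum_coef s 0.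
Proof.
move=> s0; have -> : psum_coef s 0 = \sum_(p <- s | p \in s) (p.2 == 0)%:R * p.1.
  rewrite -big_seq /psum_coef big_mkcond; apply: eq_bigr => p _.
  by case: eqP; rewrite ?mul1r ?mul0r.
rewrite /psum; under eq_fun do rewrite big_seq.
apply: cvg_sumr => p /s0; rewrite le_eqVlt => /predU1P p0; apply: cvgM; last exact: cvg_cst.
case: p0 => [<-|p0]; last by rewrite (gt_eqF p0); exact: powR_cvg0.
by rewrite eqxx; under eq_fun do rewrite powRr0; exact: cvg_cst.
Qed.

Lemma expands_cvg g s : expands g s -> g t @[t --> 0^'+] --> psum_coef s 0.
Proof.
move=> [s0 /littleo_cvg0 gs].
have : (g t - psum s t + psum s t : R) @[t --> 0^'+] --> (0 + psum_coef s 0 : R).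
  by apply: cvgD => //; exact: psum_cvg0.
by rewrite add0r; under eq_fun do rewrite subrK.
Qed.

(** With P and Q the two power sums, gh - PQ = (g - P)h + P(h - Q). Nonnegative exponents make [h]
    and P convergent at 0+, so both terms are o(t). *)
Lemma expandsM g h s u : expands g s -> expands h u ->
  expands (fun t => g t * h t) (pmul s u).
Proof.
move=> gs hu; have [[s0 go] [u0 ho]] := (gs, hu); split.
  by move=> _ /allpairsP[[p q] [/s0 ? /u0 ? ->]]; exact: addr_ge0.
have o1 := littleoMr go (expands_cvg hu).
have o2 := littleoMl (psum_cvg0 s0) ho.
apply: littleo_le (littleD o1 o2); near=> t.
have t0 : 0 < t by near: t; exact: nbhs_right_gt.
rewrite (psum_pmul _ _ t0).
suff -> : g t * h t - psum s t * psum u t =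
    (g t - psum s t) * h t + psum s t * (h t - psum u t) by [].
ring.
Unshelve. all: by end_near. Qed.

Lemma expands_cst (c : R) : expands (fun=> c) [:: (c, 0)].
Proof.
split; first by move=> p; rewrite inE => /eqP ->.
by apply: eq_little little0 => t; rewrite /psum big_seq1 powRr0 mul1r subrr.
Qed.

Lemma expands_prod (I : Type) (K : seq I) (g : I -> R -> R) (e : I -> seq (R * R)) :
  (forall k, expands (g k) (e k)) ->
  expands (fun t => \prod_(k <- K) g k t) (foldr (fun k => pmul (e k)) [:: (1, 0)] K).
Proof.
move=> ge; elim: K => [|k K IH]/=.
  by under eq_fun do rewrite big_nil; exact: expands_cst.
by under eq_fun do rewrite big_cons; exact: expandsM.
Qed.

Lemma expands_plin (I : Type) (K : seq I) (g : I -> R -> R) (c : I -> R) e :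
  (forall k, expands (g k) (e k)) ->
  expands (fun t => \sum_(k <- K) c k * g k t) (plin K c e).
Proof.
move=> ge; split.
  move=> p; elim: K => [|k K IH]//=; rewrite mem_cat => /orP[|//].
  by move=> /mapP[q qe ->] /=; case: (ge k) => /(_ _ qe).
have go k : xpredT k ->
    (fun t => c k * (g k t - psum (e k) t) : R^o) =o_ (0^'+) (id : R -> R^o).
  by move=> _; exact: littleoMl (cvg_cst _) (ge k).2.
apply: eq_little (littleo_sum K go) => t; rewrite psum_plin -sumrB.
by apply: eq_bigr => k _; rewrite mulrBr.
Qed.

(* All exponents of the expansion of [g ^+ n] are at least [n * a]. *)
Lemma expands_expn_littleo g s (a : R) n :
  expands g s -> (forall p, p \in s -> a <= p.2) -> 1 < n%:R * a ->
  (fun t => g t ^+ n : R^o) =o_ (0^'+) (id : R -> R^o).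
Proof.
move=> gs sa na.
have [_ go] := @expands_prod _ (nseq n tt) _ _ (fun _ => gs).
have {}go : (fun t => g t ^+ n - psum (iter n (pmul s) [:: (1, 0)]) t : R^o)
    =o_ (0^'+) (id : R -> R^o).
  apply: eq_little go => t; congr (_ - psum _ _).
    by rewrite big_nseq iter_mulr_1.
  by elim: (n) => //= k ->.
suff po : (psum (iter n (pmul s) [:: (1, 0)]) : R -> R^o) =o_ (0^'+) (id : R -> R^o).
  by apply: eq_little (littleD go po) => t; rewrite subrK.
have big p : p \in iter n (pmul s) [:: (1, 0)] -> 1 < p.2.
  move=> pn; apply: lt_le_trans na _.
  elim: n p pn {go} => [|n IH] p /=.
    by rewrite inE mul0r => /eqP ->.
  move=> /allpairsP[[q r]/= [/sa qa /IH ra ->]]/=.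
  by rewrite -natr1 mulrDl mul1r addrC lerD.
have o p : p \in iter n (pmul s) [:: (1, 0)] ->
    (fun t => t `^ p.2 * p.1 : R^o) =o_ (0^'+) (id : R -> R^o).
  by move=> /big p1; exact: littleoMr (littleo_powR p1) (cvg_cst _).
by apply: eq_little (littleo_sum (iter n (pmul s) [:: (1, 0)]) o) => t; rewrite -big_seq.
Qed.

(** [N] is chosen before [g], from the least exponent in [s]: one truncation order must serve all
    representatives of a Fermat point. *)
Lemma expands_expn_littleo_ex s : (forall p, p \in s -> 0 < p.2) ->
  exists N, forall g n, expands g s -> (N <= n)%N ->
    (fun t => g t ^+ n : R^o) =o_ (0^'+) (id : R -> R^o).
Proof.
move=> s0.
have [a a0 sa] : exists2 a, 0 < a & forall p, p \in s -> a <= p.2.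
  elim: s s0 => [|p s IH] s0; first by exists 1.
  have [|a a0 sa] := IH; first by move=> q qs; apply: s0; rewrite inE qs orbT.
  exists (Num.min a p.2); first by rewrite lt_min a0 s0// mem_head.
  move=> q; rewrite inE => /predU1P[->|/sa aq]; first by rewrite ge_min lexx orbT.
  by rewrite ge_min aq.
have [N Na] : exists N : nat, 1 < N%:R * a.
  exists (Num.trunc a^-1).+1; rewrite -ltr_pdivrMr// mul1r.
  exact: Num.Theory.truncnS_gt.
exists N => g n gs Nn; apply: (expands_expn_littleo gs sa); apply: lt_le_trans Na _.
by apply: ler_wpM2r; rewrite ?ler_nat// ltW.
Qed.

End GeneralizedPolynomials.

(** * Coefficients of Fermat reals *)

Section FermatRealCoefficients.
Context {R : realType}.
Implicit Types (s : seq (R * R)) (i : R) (y : lop [set: R^o]) (X : fermat_real R).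

(** [has_expansion] takes the value at 0 as constant term, hence the second hypothesis; the entries
    of exponent 0 are merged into that value. *)
Lemma has_expansion_expands (g : R -> R^o) s :
  expands g s -> psum_coef s 0 = g 0 -> has_expansion g.
Proof.
move=> [s0 gs] g0; exists [seq p <- s | p.2 != 0].
  by move=> p; rewrite mem_filter lt_neqAle eq_sym => /andP[-> /s0].
apply: eq_little gs => t; rewrite -g0 /psum big_filter (bigID (fun p => p.2 == 0))/=.
congr (_ - (_ + _)); apply: eq_bigr => p /eqP ->.
by rewrite powRr0 mul1r.
Qed.

Lemma expands_lop y : exists s, expands y s.
Proof.
have [s s0 ys] := lop_expansion y; exists ((y 0, 0) :: s); split.
  by move=> p; rewrite inE => /predU1P[->|/s0/ltW].
apply: eq_little ys => t; rewrite /psum big_cons powRr0 mul1r.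
by congr (_ - _).
Qed.

Lemma expands_lop0 y s : expands y s -> psum_coef s 0 = y 0.
Proof.
have [u u0 yu] := lop_expansion y => ys.
rewrite (@expands_coef_eq _ y s ((y 0, 0) :: u)) ?ler01//.
  rewrite psum_coef_cons eqxx /psum_coef big_seq_cond big_pred0 ?addr0// => p.
  by apply/negbTE/negP => /andP[/u0/gt_eqF ->].
split; first by move=> p; rewrite inE => /predU1P[->|/u0/ltW].
apply: eq_little yu => t; rewrite /psum big_cons powRr0 mul1r.
by congr (_ - _).
Qed.

Lemma standard_part_pi (V : normedModType R) (U : set V) (x : lop U) :
  standard_part (\pi_(fermat U) x) = x 0.
Proof.
by have /eqP/fermatP[] := reprK (\pi_(fermat U) x).
Qed.

Lemma fsum_seq (W : nmodType) (r : seq R) (F : R -> W) : uniq r ->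
  (forall i, i \in r -> 0 < i <= 1) ->
  (forall i, i \notin r -> F i = 0) ->
  \sum_(i \in `]0, 1]%classic) F i = \sum_(i <- r) F i.
Proof.
move=> ur r01 F0; rewrite [RHS]fsbig_seq//; apply/esym/fsbig_widen.
  by move=> i /= /r01; rewrite in_itv.
by move=> i /= [_ /negP]; exact: F0.
Qed.

Lemma finite_support_seq (V : zmodType) (alpha : R -> V) :
  finite_set [set i | alpha i != 0] ->
  (forall i, ~ `]0, 1]%classic i -> alpha i = 0) ->
  exists r, [/\ uniq r, (forall i, i \in r -> 0 < i <= 1) &
    (forall i, i \notin r -> alpha i = 0)].
Proof.
move=> /finite_seqP[r ar] a0; exists (undup r).
have mr i : (i \in undup r) = (alpha i != 0).
  rewrite mem_undup; apply/idP/idP => h.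
    by have : [set` r] i by []; rewrite -ar.
  by have : [set i | alpha i != 0] i by []; rewrite ar.
split => [|i|i]; first exact: undup_uniq; rewrite mr; last by rewrite negbK => /eqP.
by apply: contraR => i01; apply/eqP/a0; rewrite /= in_itv; exact/negP.
Qed.

Lemma expands_map (g : R -> R) c (r : seq R) (alpha : R -> R) :
  (forall i, i \in r -> 0 < i <= 1) ->
  (\forall t \near 0^'+, g t = c + \sum_(i <- r) t `^ i * alpha i) ->
  expands g ((c, 0) :: [seq (alpha i, i) | i <- r]).
Proof.
move=> r01 gE; apply: expands_near (expands_psum _) => [|p].
  by apply: filterS gE => t ->; rewrite /psum big_cons big_map powRr0 mul1r.
by rewrite inE => /predU1P[->//|/mapP[j /r01/andP[/ltW ? _] ->]].
Qed.

(** A quasi-decomposition supplies a representative that is, near 0+, exactly a finite sum of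
    powers; comparing it with [y] by [expands_coef_eq] identifies the coefficients, whence also
    their uniqueness. *)
Lemma quasi_decomposition_coef y s (alpha : R -> R^o) i : expands y s ->
  quasi_decomposition (\pi_(fermat_real R) y : fermat [set: R^o]) alpha ->
  0 < i <= 1 -> alpha i = psum_coef s i.
Proof.
move=> ys [afin a0 [x /eqP/fermatP[yx0 yx] xE]] /andP[i0 i1].
have [r [ur r01 rE]] := finite_support_seq afin a0.
have xu : expands x ((y 0 : R, 0) :: [seq (alpha i : R, i) | i <- r]).
  apply: expands_map => //; near=> t.
  rewrite xE; last first.
    apply/andP; split; first by apply/ltW; near: t; exact: nbhs_right_gt.
    by near: t; apply: nbhs_right_lt; exact: lop_eps_gt0.
  by rewrite (fsum_seq ur r01) ?standard_part_pi// => j /rE ->; rewrite scaler0.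
rewrite (expands_coef_eq ys (expandsD_little yx xu))//.
rewrite psum_coef_cons/= eq_sym gt_eqF// add0r psum_coef_map//.
by case: ifPn => // /rE.
Unshelve. all: by end_near. Qed.

(** Keep the value at 0 and the collected terms with exponent in (0, 1] of an expansion of a
    representative; what is dropped is o(t), so the class is unchanged. *)
Lemma quasi_decomposition_exists X :
  exists alpha, quasi_decomposition (X : fermat [set: R^o]) alpha.
Proof.
rewrite -(reprK X); move: (repr X) => y {X}.
have [s ys] := expands_lop y.
pose r := [seq i <- undup (map snd s) | 0 < i <= 1].
have ur : uniq r by rewrite filter_uniq// undup_uniq.
have r01 i : i \in r -> 0 < i <= 1 by rewrite mem_filter => /andP[].
pose alpha i : R^o := if 0 < i <= 1 then psum_coef s i else 0.
have rE i : i \notin r -> alpha i = 0.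
  rewrite mem_filter mem_undup /alpha; case: ifP => //= _.
  exact: psum_coef_notin.
pose g t : R^o := y 0 + \sum_(i \in `]0, 1]%classic) t `^ i *: alpha i.
have gE t : g t = y 0 + \sum_(i <- r) t `^ i * alpha i.
  by rewrite /g (fsum_seq ur r01)// => j /rE ->; rewrite scaler0.
have gu : expands g ((y 0 : R, 0) :: [seq (alpha i : R, i) | i <- r]).
  by apply: expands_map => //; near=> t; exact: gE.
have g0 : g 0 = y 0.
  rewrite gE big1_seq ?addr0// => i /= /r01 /andP[i0 _].
  by rewrite powR0 ?gt_eqF// mul0r.
have gexp : has_expansion g.
  apply: (has_expansion_expands gu); rewrite g0 psum_coef_cons eqxx psum_coef_map//.
  by case: ifPn => [/r01|]; rewrite ?addr0// ltxx.
exists alpha; split.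
- apply: (sub_finite_set _ (finite_seq r)) => i /=; apply: contraNT.
  by move=> /rE ->.
- by move=> i; rewrite /= in_itv/= /alpha => /negP/negbTE ->.
exists (@Lop _ _ [set: R^o] g 1 ltr01 (fun _ _ => I) gexp); last first.
  by move=> t _; rewrite standard_part_pi.
apply/eqP/fermatP; split => //=.
apply: (expands_littleo ys gu) => i /andP[]; rewrite le_eqVlt => /predU1P[<- _|i0 i1].
  rewrite (expands_lop0 ys) psum_coef_cons eqxx psum_coef_map//.
  by case: ifPn => [/r01|]; rewrite ?addr0// ltxx.
rewrite psum_coef_cons/= eq_sym gt_eqF// add0r psum_coef_map//.
rewrite /alpha i0 i1; case: ifPn => //; rewrite mem_filter i0 i1 mem_undup/=.
exact: psum_coef_notin.
Unshelve. all: by end_near. Qed.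

(** The standard part is filed as the coefficient at exponent 0, so that it needs no separate
    treatment in linearity, norm estimates and limits. *)
Definition fermat_coef X i : R := if i == 0 then standard_part X else quasi_coef X i.

Lemma quasi_coefP X : quasi_decomposition (X : fermat [set: R^o]) (quasi_coef X).
Proof. exact: getPex (quasi_decomposition_exists X). Qed.

Lemma fermat_coef_expands y s i : expands y s -> 0 <= i <= 1 ->
  fermat_coef (\pi_(fermat_real R) y) i = psum_coef s i.
Proof.
move=> ys /andP[]; rewrite le_eqVlt /fermat_coef => /predU1P[<- _|i0 i1].
  by rewrite eqxx standard_part_pi (expands_lop0 ys).
rewrite gt_eqF//; apply: quasi_decomposition_coef (quasi_coefP _) _ => //.
by rewrite i0.
Qed.

Lemma fermat_coefB X Y i : 0 <= i <= 1 ->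
  fermat_coef (X - Y) i = fermat_coef X i - fermat_coef Y i.
Proof.
move=> i01; rewrite -(reprK X) -(reprK Y); move: (repr X) (repr Y) => x y.
have [[s xs] [u yu]] := (expands_lop x, expands_lop y).
rewrite -[- _]pi_fermat_realN -[_ + _]pi_fermat_realD.
rewrite (fermat_coef_expands xs)// (fermat_coef_expands yu)//.
pose c b : R := if b then 1 else -1.
pose e b := if b then s else u.
pose g b := if b then x : R -> R else y : R -> R.
have ge b : expands (g b) (e b) by case: b.
have := @expands_plin _ _ [:: true; false] g c e ge.
under eq_fun do rewrite !big_cons big_nil/= mul1r mulN1r addr0.
move=> xy; rewrite (@fermat_coef_expands (lopD x (lopN y)) _ _ xy i01).
by rewrite psum_coef_plin !big_cons big_nil/= mul1r mulN1r addr0.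
Qed.

Lemma fermat_innerE X (r : seq R) : uniq r -> (forall i, i \in r -> 0 < i <= 1) ->
  (forall i, 0 < i <= 1 -> i \notin r -> fermat_coef X i = 0) ->
  fermat_inner X X = fermat_coef X 0 ^+ 2 + \sum_(i <- r) fermat_coef X i ^+ 2.
Proof.
move=> ur r01 rE; rewrite /fermat_inner (fsum_seq ur r01) => [|i ir].
  congr (_ + _); first by rewrite /fermat_coef eqxx.
  apply: eq_big_seq => i /r01 /andP[i0 _].
  by rewrite /fermat_coef gt_eqF.
have [_ a0 _] := quasi_coefP X.
have [i01|i01] := boolP (0 < i <= 1).
  have := rE _ i01 ir; rewrite /fermat_coef gt_eqF; last by case/andP: i01.
  by move=> ->; rewrite mul0r.
by rewrite a0 ?mul0r//= in_itv/=; exact/negP.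
Qed.

Lemma fermat_inner_sum X : exists r, fermat_inner X X =
  fermat_coef X 0 ^+ 2 + \sum_(i <- r) fermat_coef X i ^+ 2 /\
  forall i, 0 < i <= 1 -> i \notin r -> fermat_coef X i = 0.
Proof.
have [afin a0 _] := quasi_coefP X.
have [r [ur r01 rE]] := finite_support_seq afin a0.
have cE i : 0 < i <= 1 -> i \notin r -> fermat_coef X i = 0.
  by move=> /andP[i0 _] /rE; rewrite /fermat_coef gt_eqF.
by exists r; rewrite (fermat_innerE ur r01).
Qed.

Lemma fermat_coef_le_norm X i : 0 <= i <= 1 -> `|fermat_coef X i| <= fermat_norm X.
Proof.
move=> i01; rewrite -sqrtr_sqr ler_wsqrtr//.
have [r [-> rE]] := fermat_inner_sum X.
have sum0 (u : seq R) : 0 <= \sum_(i <- u) fermat_coef X i ^+ 2.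
  by apply: sumr_ge0 => j _; exact: sqr_ge0.
have [->|i0] := eqVneq i 0; first by rewrite lerDl.
have i01' : 0 < i <= 1 by rewrite lt_neqAle eq_sym i0.
have [ir|/rE ->//] := boolP (i \in r); last by rewrite expr0n/= addr_ge0 ?sqr_ge0.
rewrite (big_rem i)//= addrCA lerDl addr_ge0 ?sqr_ge0//.
Qed.

(** Convergence is tested on the set of [Y] whose coefficient is within [e] of that of [L]; this set
    is open by [fermat_coef_le_norm] applied to a difference. *)
Lemma fermat_coef_cvg (g : nat -> fermat_real R) L i : 0 <= i <= 1 ->
  g n @[n --> \oo] --> L -> fermat_coef (g n) i @[n --> \oo] --> fermat_coef L i.
Proof.
move=> i01 gL; apply/cvgrPdist_lt => e e0.
have : nbhs L [set Y | `|fermat_coef L i - fermat_coef Y i| < e].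
  apply: open_nbhs_nbhs; split; last by rewrite /= subrr normr0.
  rewrite fermat_real_openE => X /= Xe.
  exists (e - `|fermat_coef L i - fermat_coef X i|); first by rewrite subr_gt0.
  move=> Y; rewrite ltrBrDl => /(le_lt_trans _) YX.
  rewrite -(subrKA (fermat_coef X i)); apply: le_lt_trans (ler_normD _ _) (YX _ _).
  by rewrite lerD2l distrC -fermat_coefB// fermat_coef_le_norm.
exact: gL.
Qed.

Lemma fermat_norm_cvg (g : nat -> fermat_real R) L :
  fermat_norm (g n - L) @[n --> \oo] --> (0 : R) -> g n @[n --> \oo] --> L.
Proof.
move=> /cvgr0Pnorm_lt gL A; rewrite nbhsE => -[B [oB BL] BA].
move: oB; rewrite fermat_real_openE => /(_ _ BL)[e e0 eB].
apply: filterS (gL _ e0) => n ne; apply/BA/eB.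
by apply: le_lt_trans ne; exact: ler_norm.
Qed.

End FermatRealCoefficients.

(** * Taylor expansion *)

Section Taylor.
Context {R : realType}.

(** [phi q] stands for the q-th derivative of [phi 0]. The derivative of the remainder is the
    remainder, of order one less, of the shifted family; the mean value theorem from 0, where the
    remainder vanishes, gains a factor |x|. The 1/N! of the sharp bound is given up. *)
Lemma taylor_le (N : nat) (phi : nat -> R -> R) (d C : R) :
  (forall q (x : R), (q < N)%N -> `|x| < d -> is_derive x 1 (phi q) (phi q.+1 x)) ->
  (forall x, `|x| < d -> `|phi N x| <= C) ->
  forall x, `|x| < d ->
    `|phi 0%N x - \sum_(q < N) phi q 0 * (x ^+ q / q`!%:R)| <= C * `|x| ^+ N.
Proof.
elim: N phi => [|N IH] phi dphi phiC x xd.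
  by rewrite big_ord0 subr0 expr0 mulr1; exact: phiC.
pose T := \poly_(q < N.+1) (phi q 0 / q`!%:R).
have TE y : T.[y] = \sum_(q < N.+1) phi q 0 * (y ^+ q / q`!%:R).
  by rewrite horner_poly; apply: eq_bigr => q _; rewrite mulrAC mulrA.
have T'E y : T^`().[y] = \sum_(q < N) phi q.+1 0 * (y ^+ q / q`!%:R).
  have -> : T^`() = \poly_(q < N) (phi q.+1 0 / q`!%:R).
    apply/polyP => q; rewrite coef_deriv !coef_poly ltnS; case: ifP; rewrite ?mul0rn//.
    move=> _; rewrite -[LHS]mulr_natr factS natrM; field.
    by rewrite nat1r !pnatr_eq0 -lt0n fact_gt0.
  by rewrite horner_poly; apply: eq_bigr => q _; rewrite mulrAC mulrA.
pose F y := phi 0%N y - T.[y].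
have dF (y : R) : `|y| < d -> is_derive y 1 F (phi 1%N y - T^`().[y]).
  by move=> yd; apply: is_deriveB; exact: dphi.
have F'C y : `|y| < d -> `|phi 1%N y - T^`().[y]| <= C * `|y| ^+ N.
  move=> yd; rewrite T'E; apply: (IH (fun q => phi q.+1)) => // q z qN zd.
  exact: dphi.
have F0 : F 0 = 0.
  rewrite /F TE big_ord_recl/= expr0 fact0 divr1 mulr1 big1 ?addr0 ?subrr// => q _.
  by rewrite exprS mul0r mul0r mulr0.
(* Stated for a general interval because it serves both [0, x] and [x, 0], according to the sign of
   [x]. *)
have MVT_F a b : a <= b -> `|a| < d -> `|b| < d ->
    exists2 c, a <= c <= b & F b - F a = (phi 1%N c - T^`().[c]) * (b - a).
  move=> ab ad bd.
  have cd c : c \in `[a, b] -> `|c| < d.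
    rewrite in_itv/= => /andP[ac cb]; rewrite ltr_norml.
    move: ad bd; rewrite !ltr_norml => /andP[? _] /andP[_ ?].
    by apply/andP; split; [exact: lt_le_trans ac | exact: le_lt_trans cb _].
  have dFab (c : R) : c \in `]a, b[%R -> is_derive c 1 F (phi 1%N c - T^`().[c]).
    by move=> cab; apply/dF/cd; exact: subset_itv_oo_cc cab.
  have Fab : {within `[a, b], continuous F}.
    by apply: derivable_within_continuous => c /cd /dF [].
  have [c cab E] := MVT_segment ab dFab Fab.
  by rewrite in_itv/= in cab; exists c.
rewrite -TE -/(F x) -[F x]subr0 -F0.
have bound c : `|c| <= `|x| ->
    `|(phi 1%N c - T^`().[c]) * x| <= C * `|x| ^+ N.+1.
  move=> cx; rewrite normrM exprSr mulrA ler_wpM2r//.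
  have C0 : 0 <= C by rewrite (le_trans _ (phiC x xd)).
  apply: le_trans (F'C _ (le_lt_trans cx xd)) _.
  by rewrite ler_wpM2l// lerXn2r// nnegrE.
have d0 : `|0 : R| < d by rewrite normr0 (le_lt_trans _ xd).
have [x0|/ltW x0] := leP 0 x.
  have [c /andP[c0 cx] ->] := MVT_F _ _ x0 d0 xd.
  by rewrite subr0; apply: bound; rewrite !ger0_norm.
have [c /andP[xc c0] E] := MVT_F _ _ x0 xd d0.
have -> : F x - F 0 = (phi 1%N c - T^`().[c]) * x.
  by apply: oppr_inj; rewrite opprB E sub0r mulrN.
by apply: bound; rewrite !ler0_norm// lerN2.
Qed.

End Taylor.

Section SmoothTaylor.
Context {R : realType} {m : nat}.
Implicit Types (f : 'rV[R]_m -> R) (U : set 'rV[R]_m) (z : R -> 'rV[R]_m).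

Local Notation e_ j := (delta_mx ord0 j : 'rV[R]_m).

Lemma smooth_on_iter U f s : smooth_on U f -> smooth_on U (iter_partial s f).
Proof. by move=> fU s' x Ux; rewrite /iter_partial -foldr_cat; exact: fU. Qed.

Lemma is_derive_line U f j (y : 'rV[R]_m) (u : R) : smooth_on U f ->
  U (y + u *: e_ j) ->
  is_derive u 1 (fun v : R => f (y + v *: e_ j)) (partial j f (y + u *: e_ j)).
Proof.
move=> /(_ [::]) fU /fU[_ /(_ j) fd].
have E : (fun h : R => h^-1 *: (f (y + (h *: 1 + u) *: e_ j) - f (y + u *: e_ j))) =
    (fun h : R => h^-1 *: (f (h *: e_ j + (y + u *: e_ j)) - f (y + u *: e_ j))).
  apply/funext => h; congr (_ *: (f _ - _)).
  by rewrite [h *: 1]mulr1 scalerDl addrCA.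
split; first by rewrite /derivable/= E; exact: fd.
by rewrite /partial /derive/= E.
Qed.

(** The base point [z t] moves with t, so the remainder must be bounded uniformly near [r];
    continuity at [r] of the N-th partial derivative in direction [j] provides the bound [C]. *)
Lemma coord_taylor U f j N (r : 'rV[R]_m) z (d : R -> R) :
  open U -> smooth_on U f -> U r ->
  z t @[t --> 0^'+] --> r -> d t @[t --> 0^'+] --> (0 : R) ->
  (fun t => d t ^+ N : R^o) =o_ (0^'+) (id : R -> R^o) ->
  (fun t => f (z t + d t *: e_ j) -
    \sum_(q < N) iter_partial (nseq q j) f (z t) * (d t ^+ q / q`!%:R) : R^o)
  =o_ (0^'+) (id : R -> R^o).
Proof.
move=> oU fU Ur zr d0 dN.
pose C : R := `|iter_partial (nseq N j) f r| + 1.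
have [e e0 re] : exists2 e : R, 0 < e & forall y, `|r - y| < e ->
    U y /\ `|iter_partial (nseq N j) f y| <= C.
  have rC : \forall y \near r, `|iter_partial (nseq N j) f y| <= C.
    have [/cvgrPdist_le/(_ _ ltr01) + _] := fU (nseq N j) r Ur.
    apply: filterS => y /= yr; rewrite /C addrC -lerBlDr.
    by apply: le_trans yr; rewrite distrC; exact: lerB_dist.
  have : \forall y \near r, U y /\ `|iter_partial (nseq N j) f y| <= C.
    by apply: filterS2 (open_nbhs_nbhs (conj oU Ur)) rC => y; split.
  by move=> /nbhs_ballP[e e0 re]; exists e => // y yr; apply: re; rewrite -ball_normE.
(* Half of [e] is left for the distance from [r] to the base point, the other half bounds the
   displacement along [e_ j]. *)
pose e1 := e / 2 / (`|e_ j| + 1).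
have ej0 : 0 < `|e_ j| + 1 by rewrite ltr_wpDl.
have e10 : 0 < e1 by rewrite !divr_gt0.
have near_r y u : `|r - y| < e / 2 -> `|u| < e1 -> `|r - (y + u *: e_ j)| < e.
  move=> yr ue; rewrite opprD addrA (splitr e).
  apply: le_lt_trans (ler_normB _ _) _; apply: ltr_leD => //.
  rewrite normrZ; apply: le_trans (ler_pM _ _ (ltW ue) (_ : _ <= `|e_ j| + 1)) _ => //.
    by rewrite lerDl.
  by rewrite /e1 divfK ?gt_eqF.
have key t : `|r - z t| < e / 2 -> `|d t| < e1 ->
    `|f (z t + d t *: e_ j) -
      \sum_(q < N) iter_partial (nseq q j) f (z t) * (d t ^+ q / q`!%:R)|
    <= `|C * d t ^+ N|.
  move=> zt dt.
  have := @taylor_le R N (fun q u => iter_partial (nseq q j) f (z t + u *: e_ j)) e1 C.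
  have C0 : 0 <= C by rewrite addr_ge0.
  rewrite normrM normrX (ger0_norm C0) scale0r addr0; apply => //.
    move=> q u _ ue; apply: (@is_derive_line U) => //; first exact: smooth_on_iter.
    by apply: (re _ _).1; exact: near_r.
  by move=> u ue; apply: (re _ _).2; exact: near_r.
apply: littleo_le (littleoMl (cvg_cst C) dN); near=> t; apply: key.
  by near: t; move/cvgrPdist_lt: zr => /(_ (e / 2)); apply; rewrite divr_gt0.
by near: t; move/cvgr0Pnorm_lt: d0 => /(_ e1); apply.
Unshelve. all: by end_near. Qed.

Definition upd N (k : {ffun 'I_m -> 'I_N.+1}) j q : {ffun 'I_m -> 'I_N.+1} :=
  [ffun i => if i == j then q else k i].

(* Expanding in the last coordinate first produces exactly the order of differentiation
   of [multi_partial], so that no symmetry of mixed partial derivatives is needed. *)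
Lemma taylor_littleo_seq U N (r : 'rV[R]_m) (js : seq 'I_m) f z :
  open U -> smooth_on U f -> U r -> uniq js ->
  z t @[t --> 0^'+] --> r ->
  (forall j, (fun t => (z t ord0 j - r ord0 j) ^+ N.+1 : R^o)
     =o_ (0^'+) (id : R -> R^o)) ->
  (forall t i, i \notin js -> z t ord0 i = r ord0 i) ->
  (fun t => f (z t) -
    \sum_(k : {ffun 'I_m -> 'I_N.+1} | [forall i, (i \notin js) ==> (k i == ord0)])
      iter_partial (flatten [seq nseq (k i) i | i <- js]) f r *
      \prod_(i <- js) ((z t ord0 i - r ord0 i) ^+ k i / (k i)`!%:R) : R^o)
  =o_ (0^'+) (id : R -> R^o).
Proof.
move=> oU fU Ur; elim/last_ind: js f fU z => [|js j IH] f fU z ujs zr zN zout.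
  apply: eq_little little0 => t.
  have -> : z t = r by apply/rowP => i; rewrite zout.
  rewrite (big_pred1 [ffun=> ord0]) => [|k].
    by rewrite big_nil mulr1 subrr.
  apply/forallP/eqP => [k0|-> i]; last by rewrite ffunE eqxx implybT.
  by apply/ffunP => i; rewrite ffunE; exact/eqP/(implyP (k0 i)).
move: ujs; rewrite rcons_uniq => /andP[jjs ujs].
pose d t := z t ord0 j - r ord0 j.
(* The same curve with its j-th coordinate frozen at that of [r]: it varies along [js] only, so the
   induction hypothesis applies along it to each pure derivative of [f] in direction [j]. *)
pose z' t := z t - d t *: e_ j.
have z'E t i : z' t ord0 i = if i == j then r ord0 j else z t ord0 i.
  rewrite !mxE/= /d; case: eqP => [->|_]; last by rewrite mulr0 subr0.
  by rewrite mulr1; ring.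
have dcvg : d t @[t --> 0^'+] --> (0 : R).
  have H : (z t ord0 j : R) @[t --> 0^'+] --> (r ord0 j : R).
    exact: (cvg_comp _ _ zr (@coord_continuous R 1 m ord0 j r)).
  have H0 : d t @[t --> 0^'+] --> (r ord0 j - r ord0 j : R).
    by apply: cvgB => //; exact: cvg_cst.
  by rewrite subrr in H0.
have z'r : z' t @[t --> 0^'+] --> r.
  have H : (z t - d t *: e_ j) @[t --> 0^'+] --> r - 0 *: e_ j.
    by apply: cvgB => //; apply: cvgZr_tmp.
  by rewrite scale0r subr0 in H.
have zE t : z t = z' t + d t *: e_ j by rewrite subrK.
have z'N i : (fun t => (z' t ord0 i - r ord0 i) ^+ N.+1 : R^o)
    =o_ (0^'+) (id : R -> R^o).
  have [->|ij] := eqVneq i j.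
    by apply: eq_little little0 => t; rewrite z'E eqxx subrr expr0n.
  by apply: eq_little (zN i) => t; rewrite z'E (negbTE ij).
have z'out t i : i \notin js -> z' t ord0 i = r ord0 i.
  rewrite z'E; case: eqVneq => [->//|ij ijs]; apply: zout.
  by rewrite mem_rcons inE (negbTE ij).
pose w (q : nat) t := d t ^+ q / q`!%:R.
have wcvg q : w q t @[t --> 0^'+] --> (0 ^+ q / q`!%:R : R).
  apply: cvgM; last exact: cvg_cst.
  exact: (cvg_comp _ _ dcvg (@exprn_continuous R q 0)).
pose S (q : nat) t := \sum_(k : {ffun 'I_m -> 'I_N.+1} |
    [forall i, (i \notin js) ==> (k i == ord0)])
  iter_partial (flatten [seq nseq (k i) i | i <- js]) (iter_partial (nseq q j) f) r *
  \prod_(i <- js) ((z' t ord0 i - r ord0 i) ^+ k i / (k i)`!%:R).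
have So (q : 'I_N.+1) : xpredT q ->
    (fun t => (iter_partial (nseq q j) f (z' t) - S q t) * w q t : R^o)
    =o_ (0^'+) (id : R -> R^o).
  move=> _; apply: littleoMr (wcvg q).
  exact: IH (smooth_on_iter _ fU) _ ujs z'r z'N z'out.
(* The error splits into that of the expansion in direction [j] about the moving point [z' t], and
   those of expanding its coefficients along [js], weighted by the convergent factors [w q]. *)
apply: eq_little (littleD (coord_taylor j oU fU Ur z'r dcvg (zN j)) (littleo_sum (index_enum 'I_N.+1) So)) => t.
rewrite -zE; under [X in _ + X = _]eq_bigr do rewrite mulrBl.
rewrite sumrB addrA subrK; congr (_ - _).
under eq_bigr do rewrite /S mulr_suml.
rewrite pair_big/=; symmetry.
(* A multi-index supported on [rcons js j] is the same as its value at [j] together with a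
   multi-index supported on [js]. *)
rewrite (reindex_onto (fun p : 'I_N.+1 * {ffun 'I_m -> 'I_N.+1} => upd p.2 j p.1)
  (fun k => (k j, upd k j ord0)))/=; last first.
  by move=> k _; apply/ffunP => i; rewrite !ffunE; case: eqP => // ->.
apply: eq_big => [[q k]/=|[q k] _ /=].
  apply/andP/forallP => [[/forallP kout /eqP[_ kE]] i|kout].
    apply/implyP => ijs; rewrite -kE !ffunE; case: ifP => // ij.
    by have := kout i; rewrite mem_rcons inE ij ijs/= !ffunE ij.
  split.
    apply/forallP => i; rewrite mem_rcons inE negb_or !ffunE.
    by apply/implyP => /andP[/negbTE -> ijs]; exact: (implyP (kout i)).
  apply/eqP; congr pair; first by rewrite ffunE eqxx.
  apply/ffunP => i; rewrite !ffunE; case: eqP => // ->.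
  by apply/esym/eqP/(implyP (kout j)).
have jsE i : i \in js -> upd k j q i = k i.
  by move=> ijs; rewrite ffunE ifN//; apply: contraNneq jjs => <-.
rewrite -mulrA; congr (_ * _).
  rewrite -cats1 map_cat flatten_cat /= cats0 ffunE eqxx.
  rewrite /iter_partial foldr_cat; congr (foldr _ _ (flatten _) _).
  by apply/eq_in_map => i /jsE ->.
rewrite -cats1 big_cat/= big_seq1 ffunE eqxx; congr (_ * _).
apply: eq_big_seq => i ijs; rewrite jsE// z'E ifN//.
by apply: contraNneq jjs => <-.
Qed.

Lemma taylor_littleo U N (r : 'rV[R]_m) f z :
  open U -> smooth_on U f -> U r ->
  z t @[t --> 0^'+] --> r ->
  (forall j, (fun t => (z t ord0 j - r ord0 j) ^+ N.+1 : R^o)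
     =o_ (0^'+) (id : R -> R^o)) ->
  (fun t => f (z t) -
    \sum_(k : {ffun 'I_m -> 'I_N.+1}) multi_partial (fun i => k i : nat) f r *
      \prod_i ((z t ord0 i - r ord0 i) ^+ k i / (k i)`!%:R) : R^o)
  =o_ (0^'+) (id : R -> R^o).
Proof.
move=> oU fU Ur zr zN.
have zout t i : i \notin enum 'I_m -> z t ord0 i = r ord0 i by rewrite mem_enum.
apply: eq_little (taylor_littleo_seq oU fU Ur (enum_uniq _) zr zN zout) => t.
congr (_ - _); apply: eq_big => [k|k _]; last by rewrite big_enum.
by apply/forallP => i; rewrite mem_enum.
Qed.

End SmoothTaylor.

(** * Fermat extensions *)

Section FermatExtension.
Context {R : realType} {m : nat}.
Implicit Types (f : 'rV[R]_m -> R) (U : set 'rV[R]_m) (e : 'I_m -> seq (R * R)).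

Definition monomial_psum e (k : 'I_m -> nat) : seq (R * R) :=
  foldr (fun i => pmul (pmul (foldr (fun=> pmul (e i)) [:: (1, 0)] (nseq (k i) tt))
                             [:: ((k i)`!%:R^-1, 0)]))
    [:: (1, 0)] (index_enum 'I_m).

Lemma expands_monomial e (g : 'I_m -> R -> R) (k : 'I_m -> nat) :
  (forall i, expands (g i) (e i)) ->
  expands (fun t => \prod_i (g i t ^+ k i / (k i)`!%:R)) (monomial_psum e k).
Proof.
move=> ge; apply: expands_prod => i; apply: expandsM (expands_cst _).
have := expands_prod (nseq (k i) tt) (fun=> ge i).
by congr (expands _ _); apply/funext => t; rewrite big_nseq iter_mulr_1.
Qed.

(** When the coordinates are pure powers, each multi-index contributes to a single exponent; this
    lets one coefficient isolate one derivative. *)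
Lemma monomial_psum1 (a : 'I_m -> R) (k : 'I_m -> nat) :
  monomial_psum (fun i => [:: (1, a i)]) k =
  [:: (\prod_i (k i)`!%:R^-1, \sum_i (k i)%:R * a i)].
Proof.
rewrite /monomial_psum; elim: (index_enum _) => [|i s IH]/=; first by rewrite !big_nil.
rewrite IH !big_cons.
have -> : foldr (fun=> pmul [:: (1, a i)]) [:: (1, 0)] (nseq (k i) tt) =
    [:: (1, (k i)%:R * a i)].
  elim: (k i) => [|n /= ->]; first by rewrite mul0r.
  by rewrite /pmul/= mulr1 -natr1 mulrDl mul1r addrC.
by rewrite /pmul/= mul1r addr0.
Qed.

Lemma littleo_coord (M : R -> 'rV[R]_m) i : M =o_ (0^'+) (id : R -> R^o) ->
  (fun t => M t ord0 i : R^o) =o_ (0^'+) (id : R -> R^o).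
Proof.
move=> /eqoP Mo; apply/eqoP => c c0; apply: filterS (Mo c c0) => t.
apply: le_trans; rewrite [leRHS]/Num.norm/= mx_normrE.
exact: (le_bigmax _ (fun ij => `|M t ij.1 ij.2|) (ord0, i)).
Qed.

Lemma lop_coord_expands U (x : lop U) i : exists s,
  expands (fun t => x t ord0 i - x 0 ord0 i) s /\ forall p, p \in s -> 0 < p.2.
Proof.
have [s s0 xs] := lop_expansion x.
exists [seq ((p.1 : 'rV[R]_m) ord0 i, p.2) | p <- s].
have s0' p : p \in [seq ((p.1 : 'rV[R]_m) ord0 i, p.2) | p <- s] -> 0 < p.2.
  by move=> /mapP[q /s0 ? ->].
split => //; split => [p /s0'/ltW//|].
apply: eq_little (littleo_coord i xs) => t.
rewrite !mxE opprD addrA; congr (_ - _).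
by rewrite summxE /psum big_map; apply: eq_bigr => p _; rewrite mxE.
Qed.

Lemma coord_cvg (z : R -> 'rV[R]_m) (r : 'rV[R]_m) :
  (forall i, z t ord0 i - r ord0 i @[t --> 0^'+] --> (0 : R)) ->
  z t @[t --> 0^'+] --> r.
Proof.
move=> zr; apply/cvg_ballP => c c0.
have : \forall t \near 0^'+, forall i, `|z t ord0 i - r ord0 i| < c.
  by apply: filter_forall => i; have /cvgr0Pnorm_lt := zr i; exact.
apply: filterS => t zt; split => // i j.
by rewrite (ord1 i) -ball_normE/= distrC.
Qed.

Lemma lop_coord_equiv U (x x' : lop U) i s : \pi_(fermat U) x' = \pi_(fermat U) x ->
  expands (fun t => x t ord0 i - x 0 ord0 i) s ->
  expands (fun t => x' t ord0 i - x' 0 ord0 i) s.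
Proof.
move=> /eqP/fermatP[xx0 xx]; apply: expandsD_little.
apply: eq_little (littleo_coord i xx) => t.
by rewrite !mxE xx0 opprB addrA subrK.
Qed.

(** [fermat_ext] selects some pair from its graph, built on a representative x' possibly different
    from [x]. The expansion is therefore proved for all equivalent x', with lists [e] and
    derivatives taken from [x], which depend only on the class. *)
Lemma fermat_ext_expands U f (x : lop U) N e :
  open U -> smooth_on U f ->
  (forall i, expands (fun t => x t ord0 i - x 0 ord0 i) (e i)) ->
  (forall i p, p \in e i -> 0 < p.2) ->
  (forall i g, expands g (e i) ->
    (fun t => g t ^+ N.+1 : R^o) =o_ (0^'+) (id : R -> R^o)) ->
  exists y : lop [set: R^o],
    fermat_ext f (\pi_(fermat U) x) = \pi_(fermat_real R) y /\
    expands y (plin (index_enum {ffun 'I_m -> 'I_N.+1})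
      (fun k => multi_partial (fun i => k i : nat) f (x 0))
      (fun k => monomial_psum e (fun i => k i))).
Proof.
move=> oU fU xe e0 eN.
have Ux' (x' : lop U) : U (x' 0) by apply: lop_mem; rewrite lexx lop_eps_gt0.
have comp (x' : lop U) : \pi_(fermat U) x' = \pi_(fermat U) x ->
    expands (fun t => f (x' t)) (plin (index_enum {ffun 'I_m -> 'I_N.+1})
      (fun k => multi_partial (fun i => k i : nat) f (x 0))
      (fun k => monomial_psum e (fun i => k i))) /\
    f (x' t) @[t --> 0^'+] --> f (x' 0).
  move=> x'x; have xe' i := lop_coord_equiv x'x (xe i).
  have /eqP/fermatP[xx0 _] := x'x.
  have x'0 : x' t @[t --> 0^'+] --> x' 0.
    apply: coord_cvg => i; have := expands_cvg (xe' i).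
    rewrite psum_coef_notin//; apply/negP => /mapP[p /e0 + p0].
    by rewrite -p0 ltxx.
  have x'N i := eN i _ (xe' i).
  split; last first.
    by have [f0 _] := fU [::] (x' 0) (Ux' x'); exact: (cvg_comp _ _ x'0 f0).
  apply: expandsD_little (taylor_littleo oU fU (Ux' x') x'0 x'N) _.
  rewrite xx0; apply: expands_plin => k; apply: expands_monomial => i.
  by rewrite -xx0; exact: xe'.
rewrite /fermat_ext; case: xgetP => [Y -> [x' [y [xx' -> yx yE]]]|noY].
  exists y; split => //; have [+ _] := comp _ (esym xx').
  apply: expands_near; near=> t; rewrite yE//; apply/andP; split.
    by apply/ltW; near: t; exact: nbhs_right_gt.
  by near: t; apply: nbhs_right_lt; exact: lop_eps_gt0.
(* The default branch is contradictory: f o x is itself a little-oh polynomial, its constant term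
   being f (x 0) by continuity, so the graph is inhabited. *)
have [fe f0] := comp x erefl.
have fexp : has_expansion (fun t => f (x t) : R^o).
  apply: (has_expansion_expands fe).
  by rewrite -(cvg_lim _ (expands_cvg fe))//; exact: cvg_lim.
pose y := @Lop _ _ [set: R^o] _ _ (lop_eps_gt0 x) (fun _ _ => I) fexp.
by exfalso; apply: (noY (\pi_(fermat_real R) y)); exists x, y.
Unshelve. all: by end_near. Qed.

End FermatExtension.

(** * Pointwise convergence *)

Section Main.
Context {R : realType} {m : nat}.
Implicit Types (U : set 'rV[R]_m).

(** The conventions 0^0 = 1 and 0^a = 0 for nonzero a make the value at 0 agree with the constant
    coefficient. *)
Lemma lop_of_psum (s : seq (R * R)) : (forall p, p \in s -> 0 <= p.2) ->
  exists y : lop [set: R^o], expands y s.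
Proof.
move=> s0; have se := expands_psum s0.
have sexp : has_expansion (psum s : R -> R^o).
  apply: (has_expansion_expands se); rewrite /psum_coef /psum big_mkcond.
  apply: eq_bigr => p _; case: eqVneq => [->|p0]; first by rewrite powRr0 mul1r.
  by rewrite powR0// mul0r.
by exists (@Lop _ _ [set: R^o] _ 1 ltr01 (fun _ _ => I) sexp).
Qed.

Lemma base_expansion_lt (n B : nat) (k : 'I_n -> nat) : (forall i, k i < B)%N ->
  (\sum_(i < n) k i * B ^ i < B ^ n)%N.
Proof.
elim: n k => [|n IH] k kB; first by rewrite big_ord0.
rewrite big_ord_recr/= expnS.
apply: leq_trans (_ : (k ord_max).+1 * B ^ n <= _)%N; last by rewrite leq_mul2r kB orbT.
by rewrite mulSn ltn_add2r; apply: IH => i; exact: kB.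
Qed.

Lemma base_expansion_inj (n B : nat) (k l : 'I_n -> nat) :
  (forall i, k i < B)%N -> (forall i, l i < B)%N ->
  (\sum_(i < n) k i * B ^ i = \sum_(i < n) l i * B ^ i)%N -> k =1 l.
Proof.
elim: n k l => [|n IH] k l kB lB; first by move=> _ [].
rewrite !big_ord_recr/= => E i.
set k' := fun i : 'I_n => k (widen_ord (leqnSn n) i) in E.
pose l' := fun i : 'I_n => l (widen_ord (leqnSn n) i).
have kn : (\sum_(i < n) k' i * B ^ i < B ^ n)%N by apply: base_expansion_lt => j; exact: kB.
have ln : (\sum_(i < n) l' i * B ^ i < B ^ n)%N by apply: base_expansion_lt => j; exact: lB.
have Emax : k ord_max = l ord_max.
  (* Division by B^n reads off the top digit, since the lower digits add up to less than B^n. *)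
  have := congr1 (fun q => q %/ B ^ n)%N E.
  by rewrite /= ![(_ + _ * B ^ n)%N]addnC !divnMDl ?(leq_ltn_trans _ kn)// !divn_small// !addn0.
have /IH kl : (\sum_(i < n) k' i * B ^ i = \sum_(i < n) l' i * B ^ i)%N.
  by move: E; rewrite Emax => /addIn.
have [j ->|->//] := unliftP ord_max i.
have -> : lift ord_max j = widen_ord (leqnSn n) j by apply: val_inj; rewrite [LHS]lift_max.
by apply: kl => ?; [exact: kB | exact: lB].
Qed.

(** The limit is obtained by putting the limits [l] of the derivatives in the expansion. The
    coefficients of the difference are then linear in the errors [d n k - l k], with factors free of
    n. *)
Lemma Taylor_to_fermat U (f : nat -> 'rV[R]_m -> R) :
  open U -> (forall n, smooth_on U (f n)) ->
  pointwise_Taylor_convergent U f ->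
  pointwise_convergent (fun n => fermat_ext (U := U) (f n)).
Proof.
move=> oU fU fT X; rewrite -(reprK X); move: (repr X) => x {X}.
have [e eP] := choice (lop_coord_expands x).
have xe i := (eP i).1; have e0 i := (eP i).2.
have [M MP] := choice (fun i => expands_expn_littleo_ex (e0 i)).
pose N := (\max_i M i)%N.
have eN i g : expands g (e i) ->
    (fun t => g t ^+ N.+1 : R^o) =o_ (0^'+) (id : R -> R^o).
  by move=> ge; apply: (MP i) => //; apply/ltnW; rewrite ltnS; exact: leq_bigmax.
pose K := {ffun 'I_m -> 'I_N.+1}.
pose d n (k : K) := multi_partial (fun i => k i : nat) (f n) (x 0).
pose E (k : K) := monomial_psum e (fun i => k i).
have Ux : U (x 0) by apply: lop_mem; rewrite lexx lop_eps_gt0.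
have /choice[l dl] : forall k : K, exists l : R, d n k @[n --> \oo] --> l.
  by move=> k; exact: fT.
have /choice[y yP] n := fermat_ext_expands oU (fU n) xe e0 eN.
have E0 k p : p \in E k -> 0 <= p.2.
  exact: (expands_monomial (fun i => k i) xe).1.
have lE0 p : p \in plin (index_enum K) l E -> 0 <= p.2.
  by have [+ _] := expands_plin (index_enum K) l (fun k => expands_psum (E0 k)); exact.
have [z zl] := lop_of_psum lE0.
exists (\pi_(fermat_real R) z); apply: fermat_norm_cvg.
pose c n i := \sum_k (d n k - l k) * psum_coef (E k) i.
have coefE n i : 0 <= i <= 1 -> fermat_coef
    (fermat_ext (f n) (\pi_(fermat U) x) - \pi_(fermat_real R) z) i = c n i.
  move=> i01; have [-> yE] := yP n.
  rewrite fermat_coefB// (fermat_coef_expands yE)// (fermat_coef_expands zl)//.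
  rewrite !psum_coef_plin -sumrB; apply: eq_bigr => k _.
  by rewrite mulrBl.
(* All exponents in (0, 1] that the monomials can produce: this finite set contains the support of
   the difference for every n, so the norm is a fixed continuous function of finitely many null
   sequences. *)
pose r := [seq i <- undup (flatten [seq map snd (E k) | k <- index_enum K]) | 0 < i <= 1].
have ur : uniq r by rewrite filter_uniq// undup_uniq.
have r01 i : i \in r -> 0 < i <= 1 by rewrite mem_filter => /andP[].
have normE n : fermat_norm (fermat_ext (f n) (\pi_(fermat U) x) - \pi_(fermat_real R) z)
    = Num.sqrt (c n 0 ^+ 2 + \sum_(i <- r) c n i ^+ 2).
  rewrite /fermat_norm (fermat_innerE ur r01) => [|i /[dup] i01 /andP[i0 i1] ir].
    rewrite coefE ?lexx ?ler01//; congr (Num.sqrt (_ + _)).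
    by apply: eq_big_seq => i /r01 /andP[i0 i1]; rewrite coefE// ltW.
  rewrite coefE ?(ltW i0)// /c big1// => k _; rewrite psum_coef_notin ?mulr0//.
  apply: contra ir => iE; rewrite mem_filter i01 mem_undup.
  by apply/flattenP; exists (map snd (E k)) => //; apply: map_f; rewrite mem_index_enum.
under eq_fun do rewrite normE.
have c0 i : c n i @[n --> \oo] --> (0 : R).
  have -> : (0 : R) = \sum_k (l k - l k) * psum_coef (E k) i.
    by rewrite big1// => k _; rewrite subrr mul0r.
  apply: cvg_sumr => k _; apply: cvgM; last exact: cvg_cst.
  by apply: cvgB => //; exact: cvg_cst.
have c20 i : c n i ^+ 2 @[n --> \oo] --> (0 : R).
  have := cvg_comp _ _ (c0 i) (@exprn_continuous R 2 0).
  by rewrite expr0n.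
have sum0 : c n 0 ^+ 2 + \sum_(i <- r) c n i ^+ 2 @[n --> \oo] --> (0 + \sum_(i <- r) 0 : R).
  by apply: cvgD => //; apply: cvg_sumr.
rewrite big1// addr0 in sum0.
by have := cvg_comp _ _ sum0 (@sqrt_continuous R 0); rewrite sqrtr0.
Qed.

(* Witness: [a i = (M + B ^ i) / (B * M)] with [M = B ^ m]; the part [M] separates
   multi-indices of different lengths, the part [B ^ i] those of equal length. *)
Lemma separating_exponents (k0 : 'I_m -> nat) : let B := (\sum_i k0 i).+1 in
  exists a : 'I_m -> R, [/\ forall i, 1 < B%:R * a i,
    \sum_i (k0 i)%:R * a i <= 1 &
    forall k : 'I_m -> nat, (forall i, k i < B)%N ->
      \sum_i (k i)%:R * a i = \sum_i (k0 i)%:R * a i -> k =1 k0].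
Proof.
move=> B; pose M := (B ^ m)%N.
have M0 : (0 < M)%N by rewrite expn_gt0.
have k0B i : (k0 i < B)%N by rewrite ltnS (bigD1 i)//= leq_addr.
have BM0 : 0 < (B * M)%:R :> R by rewrite ltr0n muln_gt0.
have sumE (k : 'I_m -> nat) : \sum_i (k i)%:R * ((M + B ^ i)%:R / (B * M)%:R) =
    ((\sum_i k i) * M + \sum_i k i * B ^ i)%:R / (B * M)%:R :> R.
  rewrite big_distrl/= -big_split/= natr_sum mulr_suml; apply: eq_bigr => i _.
  by rewrite mulrA -natrM mulnDr.
exists (fun i => (M + B ^ i)%:R / (B * M)%:R); split.
- move=> i; rewrite mulrA ltr_pdivlMr// mul1r -natrM ltr_nat ltn_mul2l/=.
  by rewrite -addn1 leq_add2l expn_gt0.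
(* The degree of [k0] is B - 1, so the numerator is (B - 1)M plus a base-B number below M, hence at
   most BM. *)
- rewrite sumE ler_pdivrMr// mul1r ler_nat.
  rewrite [leqRHS]mulSn addnC leq_add2r.
  exact: ltnW (base_expansion_lt k0B).
move=> k kB; rewrite !sumE => /(mulIf (invr_neq0 (lt0r_neq0 BM0))) /eqP.
rewrite eqr_nat => /eqP E.
(* Reduction modulo M removes the length part and leaves two base-B numbers below M, with equal
   digits. *)
have /(congr1 (modn^~ M)) := E.
rewrite !modnMDl !modn_small ?base_expansion_lt//.
exact: base_expansion_inj.
Qed.

(** On the separating curve through [r], the coefficient at the exponent of [k0] is the derivative
    of multi-index [k0] times a nonzero constant [c]; coefficients pass to the limit by
    [fermat_coef_cvg]. *)
Lemma fermat_to_Taylor U (f : nat -> 'rV[R]_m -> R) :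
  open U -> (forall n, smooth_on U (f n)) ->
  pointwise_convergent (fun n => fermat_ext (U := U) (f n)) ->
  pointwise_Taylor_convergent U f.
Proof.
move=> oU fU fc k0 r Ur.
have [a [a1 a01 aI]] := separating_exponents k0.
(* [N.+1] is the base B of [separating_exponents]: multi-indices with entries at most [N] are
   exactly those it separates, and [a1] makes the (N+1)-st powers of the coordinates o(t). *)
set N := (\sum_i k0 i)%N in a1 aI.
have a0 i : 0 < a i.
  by have := lt_trans ltr01 (a1 i); rewrite pmulr_rgt0 ?ltr0n.
pose xf t : 'rV[R]_m := r + \row_i t `^ a i.
have xf0 : xf 0 = r.
  by apply/rowP => i; rewrite !mxE powR0 ?addr0// gt_eqF.
have xfE t i : xf t ord0 i - xf 0 ord0 i = t `^ a i.
  by rewrite xf0 !mxE addrAC subrr add0r.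
have [eps eps0 xfU] : exists2 eps : R, 0 < eps & forall t, 0 <= t < eps -> U (xf t).
  have xfr : xf t @[t --> 0^'+] --> r.
    apply: coord_cvg => i; rewrite -xf0; under eq_fun do rewrite xfE.
    exact: powR_cvg0.
  have : \forall t \near (0 : R)^'+, U (xf t).
    by apply: xfr; exact: open_nbhs_nbhs.
  rewrite near_withinE => /nbhs_ballP[eps eps0 epsU]; exists eps => // t /andP[].
  rewrite le_eqVlt => /predU1P[<- _|t0 teps]; first by rewrite xf0.
  by apply: epsU => //; rewrite -ball_normE/= sub0r normrN gtr0_norm.
have xexp : has_expansion xf.
  exists [seq (delta_mx ord0 i, a i) | i <- enum 'I_m]; first by move=> _ /mapP[i _ ->]; exact: a0.
  apply: eq_little little0 => t; rewrite big_map xf0 /xf big_enum/=.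
  suff -> : \row_i t `^ a i = \sum_i t `^ a i *: (delta_mx ord0 i : 'rV[R]_m).
    by rewrite subrr.
  by rewrite [LHS]row_sum_delta; apply: eq_bigr => i _; rewrite mxE.
pose x := Lop eps0 xfU xexp.
pose e i : seq (R * R) := [:: (1, a i)].
have xe i : expands (fun t => x t ord0 i - x 0 ord0 i) (e i).
  split; first by move=> p; rewrite inE => /eqP ->; exact: ltW (a0 i).
  by apply: eq_little little0 => t; rewrite /= xfE /psum big_seq1 mulr1 subrr.
have e0 i p : p \in e i -> 0 < p.2 by rewrite inE => /eqP ->; exact: a0.
have eN i g : expands g (e i) ->
    (fun t => g t ^+ N.+1 : R^o) =o_ (0^'+) (id : R -> R^o).
  move=> ge; apply: (expands_expn_littleo ge) (a1 i) => p.
  by rewrite inE => /eqP ->.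
have /choice[y yP] n := fermat_ext_expands oU (fU n) xe e0 eN.
have [L fL] := fc (\pi_(fermat U) x).
(* For [k0] = 0 this exponent is 0, and [fermat_coef] then reads the standard part. *)
pose i0 := \sum_i (k0 i)%:R * a i.
have i01 : 0 <= i0 <= 1.
  by rewrite a01 andbT; apply: sumr_ge0 => i _; rewrite mulr_ge0// ltW.
have k0N i : (k0 i < N.+1)%N by rewrite ltnS /N (bigD1 i)//= leq_addr.
pose c : R := \prod_i (k0 i)`!%:R^-1.
have coefE n : fermat_coef (fermat_ext (f n) (\pi_(fermat U) x)) i0 =
    multi_partial k0 (f n) r * c.
  have [-> yE] := yP n; rewrite (fermat_coef_expands yE)// psum_coef_plin.
  pose k1 : {ffun 'I_m -> 'I_N.+1} := [ffun i => Ordinal (k0N i)].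
  have k1E : (fun i => k1 i : nat) = k0 by apply/funext => i; rewrite ffunE.
  rewrite (bigD1 k1)//= k1E xf0 monomial_psum1 psum_coef1/= eqxx [X in _ + X]big1 ?addr0// => k kk1.
  rewrite monomial_psum1 psum_coef1/=.
  case: eqP => [/(aI _ (fun i => ltn_ord (k i))) kk0|]; last by rewrite mulr0.
  case/eqP: kk1; apply/ffunP => i; apply: val_inj; rewrite ffunE /=; exact: kk0.
exists (fermat_coef L i0 * c^-1).
have c0 : c != 0.
  by apply/prodf_neq0 => i _; rewrite invr_eq0 pnatr_eq0 -lt0n fact_gt0.
have -> : (fun n => multi_partial k0 (f n) r) =
    (fun n => fermat_coef (fermat_ext (f n) (\pi_(fermat U) x)) i0 * c^-1).
  by apply/funext => n; rewrite coefE mulfK.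
by apply: cvgM; [exact: fermat_coef_cvg | exact: cvg_cst].
Qed.

End Main.

Theorem theorem23 (R : realType) (m : nat) (U : set 'rV[R]_m)
    (f : nat -> 'rV[R]_m -> R) :
  open U ->
  (forall n, smooth_on U (f n)) ->
  pointwise_Taylor_convergent U f <->
  pointwise_convergent (fun n : nat => fermat_ext (U := U) (f n)).
Proof.
by move=> oU fU; split; [exact: Taylor_to_fermat | exact: fermat_to_Taylor].
Qed.
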